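(* Let $X\in\mathfrak D$ be a finite nonempty ultrametric space. Then the following statements are equivalent. (i) For every finite nonempty ultrametric space $Y\in\mathfrak D$: if $\overline{T}_X\simeq \overline{T}_Y$, then $X$ and $Y$ are weakly similar. (ii) $X\in\mathfrak T$.
   Context: An ultrametric on a set $X$ is a function $d\colon X\times X\to[0,\infty)$ with $d(x,y)=d(y,x)$, $d(x,y)=0\Leftrightarrow x=y$, and $d(x,y)\le\max\{d(x,z),d(z,y)\}$ for all $x,y,z\in X$; then $(X,d)$ is an ultrametric space. Its spectrum is $\operatorname{Sp}(X)=\{d(x,y)\colon x,y\in X\}$ and its diameter is $\operatorname{diam} X=\sup\{d(x,y)\colon x,y\in X\}$. Weak similarity: for $(X,d)$ and $(Y,\rho)$, a bijection $\Phi\colon X\to Y$ is a weak similarity if there is a strictly increasing bijection $f\colon \operatorname{Sp}(X)\to\operatorname{Sp}(Y)$ with $f(d(x,y))=\rho(\Phi(x),\Phi(y))$ for all $x,y\in X$. The spaces $X$ and $Y$ are weakly similar if a weak similarity $\Phi\colon X\to Y$ exists. Representing tree: for a finite nonempty ultrametric space $(X,d)$, the labeled rooted tree $T_X$ is built as follows. If $X$ is a one-point set, $T_X$ consists of the single node $X$ labeled $0$. If $|X|\ge 2$, let $G_X^d$ be the graph with vertex set $X$ in which $u,v$ are adjacent iff $d(u,v)=\operatorname{diam}X$; this graph is complete multipartite, with parts $X_1,\dots,X_k$, $k\ge2$ (equivalently, the parts are the classes of the equivalence relation $d(u,v)<\operatorname{diam}X$). The root of $T_X$ is $X$, labeled $\operatorname{diam}X$,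 and the nodes of the first level (children of the root) are $X_1,\dots,X_k$, labeled $\operatorname{diam}X_i$. Nodes labeled $0$ are leaves; nodes with positive label are inner (internal) nodes, and the procedure is repeated with each inner node $X_i$ in place of $X$, and so on until all nodes obtained are leaves. $\overline{T}_X$ denotes the rooted tree $T_X$ without labels. For rooted trees, $T_1\simeq T_2$ means there is a bijection of vertex sets preserving adjacency in both directions and mapping the root of $T_1$ to the root of $T_2$. $\mathfrak D$ is the class of all finite ultrametric spaces $X$ such that different internal nodes of $T_X$ have different labels. The level of a node is its distance from the root (so the root has level $0$). A rooted tree has $n$ levels if its last (largest) level is level $n$. $\mathfrak T$ is the class of all finite ultrametric spaces $X$ such that the tree $T=T_X$, with $n$ levels, satisfies: (A) there is only one inner node at the level $k$ of $T$ whenever $0\le k<n-1$; (B) if $u$ and $v$ are different inner nodes at the level $n-1$ of $T$, then the numbers of offsprings (children) of $u$ and $v$ are equal. *)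

(* Defs.v *)
From mathcomp Require Import all_boot all_order all_algebra.
From mathcomp Require Import boolp classical_sets functions reals.

Set Implicit Arguments.
Unset Strict Implicit.
Unset Printing Implicit Defensive.

Import Order.TTheory GRing.Theory Num.Theory.
Local Open Scope ring_scope.

Record is_ultrametric (R : realType) (X : finType) (d : X -> X -> R) : Prop :=
  IsUltrametric {
    ultra_ge0 : forall x y, 0 <= d x y;
    ultra_sym : forall x y, d x y = d y x;
    ultra_eq0 : forall x y, d x y = 0 <-> x = y;
    ultra_triangle : forall x y z, d x y <= Num.max (d x z) (d z y)
  }.

Definition spectrum (R : realType) (X : finType) (d : X -> X -> R) : set R :=
  [set r : R | exists x y : X, r = d x y]%classic.

Definition diam (R : realType) (X : finType) (d : X -> X -> R) (A : {set X}) : R :=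
  sup [set r : R | exists x y : X, [/\ x \in A, y \in A & r = d x y]]%classic.

(* [f] is only relevant on [spectrum d]. *)
Definition weak_similarity (R : realType) (X Y : finType)
    (d : X -> X -> R) (e : Y -> Y -> R) (Phi : X -> Y) : Prop :=
  bijective Phi /\
  exists f : R -> R,
    [/\ set_bij (spectrum d) (spectrum e) f,
        forall s t, spectrum d s -> spectrum d t -> s < t -> f s < f t
      & forall x y, f (d x y) = e (Phi x) (Phi y)].

Definition weakly_similar (R : realType) (X Y : finType)
    (d : X -> X -> R) (e : Y -> Y -> R) : Prop :=
  exists Phi : X -> Y, weak_similarity d e Phi.

(* Rooted trees are handled as rooted graphs; that [repr_tree] below is acyclic
   and connected is a consequence of its construction. *)
Record rooted_graph := RootedGraph {
  vertex :> finType;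
  adj : rel vertex;
  root : vertex
}.

Definition rooted_iso (T1 T2 : rooted_graph) : Prop :=
  exists f : T1 -> T2,
    [/\ bijective f, forall u v, adj u v = adj (f u) (f v)
      & f (root T1) = root T2].

Definition walk_from_root (T : rooted_graph) (k : nat) (v : T) : bool :=
  [exists p : k.-tuple T, path (@adj T) (root T) p && (last (root T) p == v)].

(* Graph distance to the root: the least length of a walk from the root to [v]
   (it is smaller than [#|T|] for every vertex of a connected graph). *)
Definition level (T : rooted_graph) (v : T) : nat :=
  find (fun k => walk_from_root k v) (iota 0 #|T|).

(* "[T] has [n] levels" means [n = last_level T]: the root has level 0. *)
Definition last_level (T : rooted_graph) : nat := \max_(v : T) level v.

Section RepresentingTree.
Variables (R : realType) (X : finType) (d : X -> X -> R).

Definition diam_graph (A : {set X}) : rel X := fun u v => d u v == diam d A.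

(* The parts of a complete multipartite graph are the classes of
   non-adjacency. *)
Definition parts (A : {set X}) : {set {set X}} :=
  equivalence_partition (fun u v => ~~ diam_graph A u v) A.

Definition child (A B : {set X}) : bool := (0 < diam d A) && (B \in parts A).

Definition node : finType := {A : {set X} | connect child [set: X]%SET A}.

Definition root_node : node := exist _ [set: X]%SET (connect0 child [set: X]%SET).

Definition repr_tree : rooted_graph :=
  @RootedGraph node
    (fun u v => child (val u) (val v) || child (val v) (val u)) root_node.

Definition label (u : repr_tree) : R := diam d (val (u : node)).

Definition inner (u : repr_tree) : bool := 0 < label u.

Definition children (u : repr_tree) : {set repr_tree} :=
  [set w : repr_tree | child (val (u : node)) (val (w : node))]%SET.

Definition class_D : Prop :=
  forall u v : repr_tree, inner u -> inner v -> u <> v -> label u <> label v.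

(* [k < n - 1] and [level u = n - 1] are written without truncated subtraction:
   both conditions are vacuous when [n = 0]. *)
Definition class_T : Prop :=
  let n := last_level repr_tree in
  (forall k, (k.+1 < n)%N ->
     exists! u : repr_tree, inner u /\ level u = k) /\
  (forall u v : repr_tree, inner u -> inner v -> u <> v ->
     (level u).+1 = n -> (level v).+1 = n -> #|children u| = #|children v|).

End RepresentingTree.

(* Main.v *)
(* An ultrametric is encoded by the family of its closed balls, which are the
   nodes of the representing tree, together with their diameters.  For a space in
   D the inner nodes are totally ordered by their labels; the rank of a node is
   the number of inner nodes with a larger label, and a weak similarity is the
   same thing as a bijection that preserves balls and ranks.

   (i) => (ii): adding to the labels a large multiple of any integer function that
   is monotone for inclusion gives another space in D with the same tree.  Putting
   the chain of ancestors of a node A first gives A the rank [lev A], so by (i) the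
   node of X of that rank has the level and the number of children of A.  Hence
   two inner nodes of the same level have the same number of children.  Were there
   an inner node C below that level, the node of rank [lev C] would have level
   [lev C], which fails for the labelling that lists the nodes level by level.

   (ii) => (i): two inner nodes are comparable unless they both lie on the last
   level that contains inner nodes, so the tree order of inner nodes can be read
   off their ranks, and nodes of equal rank have equally many leaf children.  A
   bijection of the points that respects the ranks of their parents is then a weak
   similarity. *)
Require Import Defs.
From HB Require Import structures.
From mathcomp Require Import all_boot all_order all_algebra.
From mathcomp Require Import boolp classical_sets functions reals.

Set Implicit Arguments.
Unset Strict Implicit.
Unset Printing Implicit Defensive.

Import Order.TTheory GRing.Theory Num.Theory.
Local Open Scope ring_scope.

(** * Closed balls and the representing tree *)

Section Balls.
Variables (R : realType) (X : finType) (d : X -> X -> R).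

(** The radius is given by a second point, so it is a distance that occurs and equals the diameter
    of the ball. *)
Definition ball (x y : X) : {set X} := [set z | d x z <= d x y]%SET.

Fact balls_key : unit. Proof. by []. Qed.

(* Locked so that [inE] leaves membership in [balls] alone. *)
Definition balls : {set {set X}} :=
  locked_with balls_key
    [set A : {set X} | [exists x, exists y, A == ball x y]]%SET.

Definition inners : {set {set X}} := [set A in balls | (1 < #|A|)%N]%SET.

Definition kids (A : {set X}) : {set {set X}} := [set B | child d A B]%SET.

(** The balls strictly above a ball form a chain, so this counts its proper ancestors; [levelE]
    identifies it with the graph distance to the root. *)
Definition lev (A : {set X}) : nat := #|[set B in balls | A \proper B]%SET|.

Definition rank (A : {set X}) : nat :=
  #|[set B in inners | diam d A < diam d B]%SET|.

Hypothesis dU : is_ultrametric d.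

Lemma dist_xx x : d x x = 0.
Proof. by apply/(ultra_eq0 dU). Qed.

Lemma dist_gt0 x y : (0 < d x y) = (x != y).
Proof.
rewrite lt_neqAle (ultra_ge0 dU) andbT eq_sym; congr (~~ _).
by apply/eqP/eqP => /(ultra_eq0 dU).
Qed.

Lemma dist_le x y z r : d x z <= r -> d z y <= r -> d x y <= r.
Proof.
by move=> xz zy; apply: le_trans (ultra_triangle dU x y z) _; rewrite ge_max xz.
Qed.

Lemma dist_lt x y z r : d x z < r -> d z y < r -> d x y < r.
Proof.
by move=> xz zy; apply: le_lt_trans (ultra_triangle dU x y z) _; rewrite gt_max xz.
Qed.

Lemma diam_eq (A : {set X}) x y : x \in A -> y \in A ->
  (forall u v, u \in A -> v \in A -> d u v <= d x y) -> diam d A = d x y.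
Proof.
move=> xA yA le_xy; rewrite /diam.
set S := (S in sup S); have Sxy : S (d x y) by exists x, y.
have ubS : ubound S (d x y) by move=> _ [u [v [uA vA ->]]]; exact: le_xy.
apply/eqP; rewrite eq_le; apply/andP; split.
  by apply: ge_sup => //; exists (d x y).
by apply: ub_le_sup => //; exists (d x y).
Qed.

Lemma ballP (A : {set X}) : reflect (exists x y, A = ball x y) (A \in balls).
Proof.
rewrite [balls]unlock inE; apply: (iffP existsP) => [[x /existsP[y /eqP ->]]|[x [y ->]]].
  by exists x, y.
by exists x; apply/existsP; exists y.
Qed.

Lemma mem_balls x y : ball x y \in balls.
Proof. by apply/ballP; exists x, y. Qed.

Lemma mem_balll x y : x \in ball x y.
Proof. by rewrite inE dist_xx (ultra_ge0 dU). Qed.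

Lemma mem_ballr x y : y \in ball x y.
Proof. by rewrite inE. Qed.

Lemma diam_ball x y : diam d (ball x y) = d x y.
Proof.
apply: diam_eq; rewrite ?mem_balll ?mem_ballr // => u v; rewrite !inE => xu xv.
by apply: (dist_le (z := x)); rewrite // (ultra_sym dU).
Qed.

Lemma ball_centerE (A : {set X}) x z :
  A \in balls -> x \in A -> (z \in A) = (d x z <= diam d A).
Proof.
case/ballP=> a [b ->]; rewrite diam_ball !inE => ax.
by apply/idP/idP => H; [apply: (dist_le (z := a))|apply: (dist_le (z := x))];
  rewrite // (ultra_sym dU).
Qed.

Lemma ball_neq0 (A : {set X}) : A \in balls -> exists x, x \in A.
Proof. by case/ballP=> x [y ->]; exists x; exact: mem_balll. Qed.

(** Write the ball as [ball d a b]. If [x] is closer to [a] than the diameter, the strict triangle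
    inequality through [x] puts [b] at full distance from [x]; otherwise [a] is. *)
Lemma ball_attained (A : {set X}) x :
  A \in balls -> x \in A -> exists2 y, y \in A & d x y = diam d A.
Proof.
move=> Ab xA; have [a [b defA]] := ballP _ Ab.
have aA : a \in A by rewrite defA mem_balll.
have bA : b \in A by rewrite defA mem_ballr.
have dA : diam d A = d a b by rewrite defA diam_ball.
case: (ltP (d x a) (diam d A)) => [xa|xa]; last first.
  by exists a => //; apply/eqP; rewrite eq_le xa andbT -ball_centerE.
exists b => //; apply/eqP; rewrite eq_le -ball_centerE // bA /=.
case: leP => // xb; suff: d a b < d a b by rewrite ltxx.
by rewrite -{2}dA; apply: (dist_lt (z := x)); rewrite // (ultra_sym dU).
Qed.

Lemma ball_eq (A : {set X}) x y :
  A \in balls -> x \in A -> d x y = diam d A -> A = ball x y.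
Proof.
by move=> Ab xA xy; apply/setP => z; rewrite (ball_centerE z Ab xA) inE xy.
Qed.

Lemma ball_subE (A B : {set X}) x :
  A \in balls -> B \in balls -> x \in A -> x \in B ->
  (A \subset B) = (diam d A <= diam d B).
Proof.
move=> Ab Bb xA xB; apply/idP/idP => [/fintype.subsetP AB|le_AB].
  have [y yA <-] := ball_attained Ab xA.
  by rewrite -(ball_centerE y Bb xB); exact: AB.
apply/fintype.subsetP => z; rewrite (ball_centerE z Ab xA) (ball_centerE z Bb xB).
by move=> zA; exact: le_trans le_AB.
Qed.

Lemma ball_min (A : {set X}) x y :
  A \in balls -> x \in A -> y \in A -> ball x y \subset A.
Proof.
move=> Ab xA yA; rewrite (ball_subE (x := x)) ?mem_balls ?mem_balll // diam_ball.
by rewrite -ball_centerE.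
Qed.

Lemma ball_properE (A B : {set X}) x :
  A \in balls -> B \in balls -> x \in A -> x \in B ->
  (A \proper B) = (diam d A < diam d B).
Proof.
by move=> Ab Bb xA xB; rewrite properE !(@ball_subE _ _ x) // -ltNge andb_idl // => /ltW.
Qed.

Lemma diam_proper (A B : {set X}) :
  A \in balls -> B \in balls -> A \proper B -> diam d A < diam d B.
Proof.
move=> Ab Bb AB; have [x xA] := ball_neq0 Ab.
by rewrite -(@ball_properE _ _ x) //; apply: (fintype.subsetP (proper_sub AB)).
Qed.

Lemma ball_xx x : ball x x = [set x]%SET.
Proof.
apply/setP => z; rewrite !inE dist_xx eq_sym.
by rewrite leNgt dist_gt0 negbK.
Qed.

Lemma diam_gt0 (A : {set X}) : A \in balls -> (0 < diam d A) = (1 < #|A|)%N.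
Proof.
case/ballP=> x [y ->]; rewrite diam_ball dist_gt0.
have [<-|xy] /= := eqVneq; first by rewrite ball_xx cards1.
by apply/esym/card_gt1P; exists x, y; rewrite mem_balll mem_ballr.
Qed.

Lemma innerP (A : {set X}) : reflect (A \in balls /\ 0 < diam d A) (A \in inners).
Proof.
rewrite inE; apply: (iffP andP) => -[Ab]; first by rewrite -diam_gt0.
by rewrite diam_gt0.
Qed.

Lemma inner_ball (A : {set X}) : A \in inners -> A \in balls.
Proof. by case/innerP. Qed.

Lemma proper_inner (A B : {set X}) :
  A \in balls -> B \in balls -> A \proper B -> B \in inners.
Proof.
move=> Ab Bb AB; rewrite inE Bb (leq_ltn_trans _ (proper_card AB)) //.
by have [x xA] := ball_neq0 Ab; apply/card_gt0P; exists x.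
Qed.

Lemma ball_inner x y : (ball x y \in inners) = (x != y).
Proof. by rewrite inE mem_balls -diam_gt0 ?mem_balls // diam_ball dist_gt0. Qed.

Lemma inner_ballP (A : {set X}) :
  reflect (exists x y, x != y /\ A = ball x y) (A \in inners).
Proof.
apply: (iffP idP) => [AI|[x [y [xy ->]]]]; last by rewrite ball_inner.
have [x [y defA]] := ballP _ (inner_ball AI).
by exists x, y; split=> //; rewrite -ball_inner -defA.
Qed.

Lemma nested (A B : {set X}) x :
  A \in balls -> B \in balls -> x \in A -> x \in B -> A \subset B \/ B \proper A.
Proof.
move=> Ab Bb xA xB; rewrite (ball_subE Ab Bb xA xB) (ball_properE Bb Ab xB xA).
by case: leP; [left|right].
Qed.

(** * Children of a ball as open balls *)

Definition open_ball x (A : {set X}) : {set X} := [set z | d x z < diam d A]%SET.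

(** By finiteness, the open ball is the closed ball whose radius is the largest distance from [x]
    below the diameter. *)
Lemma open_ball_ball x (A : {set X}) : 0 < diam d A -> open_ball x A \in balls.
Proof.
move=> A0; have xo : x \in open_ball x A by rewrite inE dist_xx.
have [z zo zmax] := arg_maxP (d x) xo.
have -> : open_ball x A = ball x z.
  apply/setP => y; rewrite [RHS]inE; apply/idP/idP => [|yz]; first exact: zmax.
  have : z \in open_ball x A by [].
  by rewrite !inE; exact: le_lt_trans.
exact: mem_balls.
Qed.

Lemma child_openP (A B : {set X}) : A \in balls ->
  reflect (0 < diam d A /\ exists2 x, x \in A & B = open_ball x A) (child d A B).
Proof.
move=> Ab; rewrite /child /parts /equivalence_partition /diam_graph.
have openE x : x \in A ->
    [set y in A | ~~ (d x y == diam d A)]%SET = open_ball x A.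
  move=> xA; apply/setP => y; rewrite !inE (ball_centerE y Ab xA).
  by rewrite lt_neqAle andbC.
apply: (iffP andP) => [[A0 /imsetP[x xA ->]]|[A0 [x xA ->]]].
  by split=> //; exists x; rewrite // openE.
by split=> //; rewrite -openE //; apply/imsetP; exists x.
Qed.

Lemma open_ball_proper x (A : {set X}) :
  A \in balls -> x \in A -> open_ball x A \proper A.
Proof.
move=> Ab xA; have [y yA xy] := ball_attained Ab xA.
rewrite properE; apply/andP; split.
  by apply/fintype.subsetP => z; rewrite inE (ball_centerE z Ab xA) => /ltW.
by apply/negP => /fintype.subsetP/(_ _ yA); rewrite inE xy ltxx.
Qed.

Lemma sub_open_ball x (A B : {set X}) : A \in balls -> B \in balls -> x \in B ->
  B \proper A -> B \subset open_ball x A.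
Proof.
move=> Ab Bb xB BA; apply/fintype.subsetP => z; rewrite (ball_centerE z Bb xB) inE.
by move=> /le_lt_trans; apply; exact: diam_proper.
Qed.

(** No ball lies strictly between [A] and its child: a point of [B] outside the open ball is at
    distance at least [diam d A] from [x]. *)
Lemma open_ball_sub x (A B : {set X}) : A \in balls -> x \in A -> B \in balls ->
  open_ball x A \proper B -> 0 < diam d A -> A \subset B.
Proof.
move=> Ab xA Bb /properP[/fintype.subsetP oB [z zB]]; rewrite inE -leNgt => zo A0.
have xB : x \in B by apply: oB; rewrite inE dist_xx.
rewrite (ball_subE Ab Bb xA xB) (le_trans zo) //.
by rewrite -(ball_centerE z Bb xB).
Qed.

(** * Depth in the tree of balls *)

Lemma lev_sub (A B : {set X}) : A \subset B -> (lev B <= lev A)%N.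
Proof.
move=> AB; apply/subset_leq_card/fintype.subsetP => C; rewrite !inE => /andP[-> BC].
exact: sub_proper_trans BC.
Qed.

Lemma lev_proper (A B : {set X}) :
  B \in balls -> A \proper B -> (lev B < lev A)%N.
Proof.
move=> Bb AB; apply/proper_card/properP; split.
  apply/fintype.subsetP => C; rewrite !inE => /andP[-> BC].
  exact: proper_trans BC.
by exists B; rewrite inE ?Bb ?AB // fintype.properxx andbF.
Qed.

Lemma lev_open_ball x (A : {set X}) : A \in balls -> x \in A -> 0 < diam d A ->
  lev (open_ball x A) = (lev A).+1.
Proof.
move=> Ab xA A0; rewrite /lev.
have -> : [set B in balls | open_ball x A \proper B]%SET
          = (A |: [set B in balls | A \proper B])%SET.
  apply/setP => B; rewrite !inE; apply/andP/orP.
    case=> Bb oB; have := open_ball_sub Ab xA Bb oB A0.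
    by rewrite finset.subEproper => /orP[/eqP->|->]; [left|right; rewrite Bb].
  case=> [/eqP ->|/andP[Bb AB]]; first by rewrite Ab open_ball_proper.
  by split=> //; apply: proper_trans AB; exact: open_ball_proper.
by rewrite cardsU1 inE fintype.properxx andbF.
Qed.

(** Reduces children to inclusion and [lev], so that bijections of balls preserving inclusion
    preserve children. Conversely, [B] lies in the open ball around one of its points, and strict
    inclusion would contradict the equality of depths. *)
Lemma childE (A B : {set X}) : A \in balls ->
  child d A B = [&& B \in balls, B \proper A & lev B == (lev A).+1].
Proof.
move=> Ab; apply/(child_openP B Ab)/and3P.
  case=> A0 [x xA ->]; split; rewrite ?open_ball_ball ?open_ball_proper //.
  by rewrite lev_open_ball.
case=> Bb BA /eqP levB; have [x xB] := ball_neq0 Bb.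
have xA : x \in A by apply: (fintype.subsetP (proper_sub BA)).
have [_ A0] := innerP _ (proper_inner Bb Ab BA).
split=> //; exists x => //; have Bo := sub_open_ball Ab Bb xB BA.
apply/eqP; rewrite finset.eqEproper Bo; apply/negP => /lev_proper.
by rewrite open_ball_ball // lev_open_ball // levB ltnn => /(_ isT).
Qed.

Lemma child_ball (A B : {set X}) : A \in balls -> child d A B -> B \in balls.
Proof. by move=> Ab; rewrite childE // => /and3P[]. Qed.

Lemma child_proper (A B : {set X}) : A \in balls -> child d A B -> B \proper A.
Proof. by move=> Ab; rewrite childE // => /and3P[]. Qed.

Lemma child_lev (A B : {set X}) : A \in balls -> child d A B -> lev B = (lev A).+1.
Proof. by move=> Ab; rewrite childE // => /and3P[_ _ /eqP]. Qed.

Lemma has_child (A : {set X}) :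
  A \in balls -> reflect (exists B, child d A B) (A \in inners).
Proof.
move=> Ab; apply: (iffP idP) => [/innerP[_ A0]|[B AB]].
  by have [x xA] := ball_neq0 Ab; exists (open_ball x A); apply/child_openP; eauto.
by apply: proper_inner (child_proper Ab AB); rewrite // (child_ball Ab AB).
Qed.

(** * Paths and parents *)

Lemma connect_sub (A B : {set X}) :
  A \in balls -> B \in balls -> A \subset B -> connect (child d) B A.
Proof.
move=> Ab Bb; move: {2}_.+1 (ltnSn #|B|) => n.
elim: n B Bb => // n IHn B Bb; rewrite ltnS => leBn AB.
have [->|neqAB] := eqVneq A B; first exact: connect0.
have pAB : A \proper B by rewrite finset.properEneq neqAB.
have [x xA] := ball_neq0 Ab.
have xB : x \in B by apply: (fintype.subsetP AB).
have [_ B0] := innerP _ (proper_inner Ab Bb pAB).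
(* Step down to the child of [B] around [x]; it still contains [A] and has fewer points. *)
apply: connect_trans (connect1 (_ : child d B (open_ball x B))) _.
  by apply/child_openP => //; split=> //; exists x.
apply: IHn; rewrite ?open_ball_ball ?sub_open_ball //.
exact: leq_trans (proper_card (open_ball_proper Bb xB)) leBn.
Qed.

Lemma connect_ball (A B : {set X}) :
  B \in balls -> connect (child d) B A -> A \in balls /\ A \subset B.
Proof.
move=> Bb /connectP[p]; elim: p B Bb => [|C p IHp] B Bb /=.
  by move=> _ ->.
case/andP=> BC pp defA; have Cb := child_ball Bb BC.
have [Ab AC] := IHp _ Cb pp defA; split=> //.
exact: fintype.subset_trans AC (proper_sub (child_proper Bb BC)).
Qed.

Lemma parent_exists (A B : {set X}) : A \in balls -> B \in balls ->
  A \proper B -> exists2 C, C \in balls & child d C A.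
Proof.
move=> Ab Bb; rewrite finset.properEneq => /andP[neqAB /connect_sub].
case/(_ Ab Bb)/connectP=> p; elim/last_ind: p => [_ /= eqAB|p C _].
  by rewrite eqAB eqxx in neqAB.
rewrite rcons_path last_rcons => /andP[pp lpC] ->; exists (last B p) => //.
by have [] := @connect_ball (last B p) B Bb; first by apply/connectP; exists p.
Qed.

Lemma parent_unique (A B C : {set X}) : B \in balls -> C \in balls ->
  child d B A -> child d C A -> B = C.
Proof.
move=> Bb Cb BA CA; have Ab := child_ball Bb BA; have [x xA] := ball_neq0 Ab.
have inD D : D \in balls -> child d D A -> x \in D.
  by move=> Db /(child_proper Db)/proper_sub/fintype.subsetP; apply.
have levBC : lev B = lev C.
  by apply: succn_inj; rewrite -(child_lev Bb BA) -(child_lev Cb CA).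
have [BC|CB] := nested Bb Cb (inD _ Bb BA) (inD _ Cb CA); last first.
  by have := lev_proper Bb CB; rewrite levBC ltnn.
apply/eqP; rewrite finset.eqEproper BC; apply/negP => /lev_proper.
by rewrite Cb levBC ltnn => /(_ isT).
Qed.

Lemma ancestor (A : {set X}) k : A \in balls -> (k < lev A)%N ->
  exists B, [/\ B \in balls, A \proper B & lev B = k].
Proof.
move: {2}(lev A) (erefl (lev A)) => n; elim: n A => [|n IHn] A levA Ab.
  by rewrite levA ltn0.
rewrite levA ltnS => kn.
have [C] : exists C, C \in [set B in balls | A \proper B]%SET.
  by apply/card_gt0P; rewrite -/(lev A) levA.
rewrite inE => /andP[Cb AC]; have [B Bb BA] := parent_exists Ab Cb AC.
have levB : lev B = n by apply: succn_inj; rewrite -(child_lev Bb BA).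
move: kn; rewrite leq_eqVlt => /orP[/eqP ->|kn].
  by exists B; split=> //; exact: child_proper Bb BA.
have [//||D [Db BD levD]] := IHn B levB; rewrite ?levB //.
by exists D; split=> //; apply: proper_trans BD; exact: child_proper Bb BA.
Qed.

(** * Nodes of the tree and their levels *)

Hypothesis X0 : (0 < #|X|)%N.

Lemma setT_ball : [set: X]%SET \in balls.
Proof.
have [x _] := card_gt0P X0; have [z _ zmax] := @arg_maxP _ _ _ x predT (d x) isT.
apply/ballP; exists x, z; apply/setP => y; rewrite !inE.
by apply/esym; exact: zmax.
Qed.

Lemma connect_setT (A : {set X}) : connect (child d) [set: X]%SET A = (A \in balls).
Proof.
apply/idP/idP => [/(connect_ball setT_ball)[]//|Ab].
exact: connect_sub Ab setT_ball (finset.subsetT _).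
Qed.

Lemma lev_setT : lev [set: X]%SET = 0%N.
Proof.
apply/eqP; rewrite cards_eq0; apply/eqP/setP => B; rewrite !inE.
by rewrite properE finset.subsetT !andbF.
Qed.

Lemma node_ball (u : repr_tree d) : val (u : node d) \in balls.
Proof. by rewrite -connect_setT; exact: valP. Qed.

Lemma nodeK (A : {set X}) : A \in balls -> {u : repr_tree d | val (u : node d) = A}.
Proof. by rewrite -connect_setT => Ac; exists (exist _ A Ac). Qed.

Lemma inner_inners (u : repr_tree d) : inner u = (val (u : node d) \in inners).
Proof. by apply/idP/innerP => [|[]//]; split; rewrite ?node_ball. Qed.

Lemma adj_lev (u v : repr_tree d) : adj u v ->
  (lev (val (v : node d)) <= (lev (val (u : node d))).+1)%N.
Proof.
case/orP=> /child_lev-> //; rewrite ?node_ball //.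
by rewrite (leq_trans (leqnSn _)) // leqnSn.
Qed.

Lemma card_repr_tree : #|repr_tree d| = #|balls|.
Proof.
by rewrite card_sig; apply: eq_card => A; rewrite -connect_setT.
Qed.

Lemma lev_lt_card (u : repr_tree d) : (lev (val (u : node d)) < #|repr_tree d|)%N.
Proof.
rewrite card_repr_tree; apply/proper_card/properP; split.
  by apply/fintype.subsetP => B; rewrite inE => /andP[].
by exists (val (u : node d)); rewrite ?node_ball // inE fintype.properxx andbF.
Qed.

(** An edge raises the depth by at most one, and the root has depth 0. *)
Lemma walk_lev k (u : repr_tree d) :
  walk_from_root k u -> (lev (val (u : node d)) <= k)%N.
Proof.
case/existsP=> p /andP[pp /eqP <-].
suff H (q : seq (repr_tree d)) (v : repr_tree d) : path (@adj _) v q ->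
    (lev (val (last v q : node d)) <= lev (val (v : node d)) + size q)%N.
  by have := H p _ pp; rewrite size_tuple lev_setT.
elim: q v => [|w q IHq] v /=; first by rewrite addn0.
case/andP=> vw /IHq /leq_trans; apply.
by rewrite addnS -addSn leq_add2r; exact: adj_lev.
Qed.

Lemma lev_walk (u : repr_tree d) : walk_from_root (lev (val (u : node d))) u.
Proof.
have [n levu] : exists n, lev (val (u : node d)) = n by eexists.
rewrite levu; elim: n u levu => [|n IHn] u levu.
  apply/existsP; exists [tuple]; rewrite /= -val_eqE /= eq_sym.
  apply/negPn/negP; rewrite -finset.properT => /lev_proper.
  by rewrite setT_ball levu ltn0 => /(_ isT).
have Ab := node_ball u.
have [C] : exists C, C \in [set B in balls | val (u : node d) \proper B]%SET.
  by apply/card_gt0P; rewrite -/(lev _) levu.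
rewrite inE => /andP[Cb AC]; have [B Bb BA] := parent_exists Ab Cb AC.
have [w defB] := nodeK Bb.
have levw : lev (val (w : node d)) = n.
  by apply: succn_inj; rewrite -levu defB -(child_lev Bb BA).
have /existsP[p /andP[pp /eqP lpw]] := IHn w levw.
apply/existsP; exists [tuple of rcons p u].
by rewrite /= rcons_path last_rcons eqxx pp lpw /= defB BA.
Qed.

Lemma levelE (u : repr_tree d) : level u = lev (val (u : node d)).
Proof.
rewrite /level; set p := (fun k => _); set n := lev _.
(* The depth is smaller than the number of nodes, so it falls in the range that [level] searches. *)
have nlt := lev_lt_card u; have pn : p n := lev_walk u.
have hasp : has p (iota 0 #|repr_tree d|).
  by apply/hasP; exists n; rewrite // mem_iota.
have flt : (find p (iota 0 #|repr_tree d|) < #|repr_tree d|)%N.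
  by move: hasp; rewrite has_find size_iota.
apply/eqP; rewrite eqn_leq; apply/andP; split; last first.
  by have := nth_find 0%N hasp; rewrite nth_iota // => /walk_lev.
rewrite leqNgt; apply/negP => /(before_find 0%N).
by rewrite nth_iota // add0n pn.
Qed.

End Balls.

(** * The classes D and T in terms of balls *)

Definition level_homogeneous (R : realType) (X : finType) (d : X -> X -> R) :=
  forall A B, A \in inners d -> B \in inners d -> A <> B -> lev d A = lev d B ->
    #|kids d A| = #|kids d B| /\
    forall C, C \in inners d -> (lev d C <= lev d A)%N.

Section Classes.
Variables (R : realType) (X : finType) (d : X -> X -> R).
Hypothesis dU : is_ultrametric d.
Hypothesis X0 : (0 < #|X|)%N.

Lemma class_DP : class_D d <-> {in inners d &, injective (diam d)}.
Proof.
split=> [dD A B AI BI eqAB|dI u v].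
  have [u defA] := nodeK dU X0 (inner_ball dU AI).
  have [v defB] := nodeK dU X0 (inner_ball dU BI).
  apply/eqP/negP => /negP neqAB.
  apply: (dD u v); rewrite ?inner_inners ?defA ?defB //.
    by move=> uv; rewrite -defA -defB uv eqxx in neqAB.
  by rewrite /label defA defB.
rewrite !inner_inners // => uI vI uv eq_lab; apply: uv; apply: val_inj.
exact: dI.
Qed.

Lemma card_children (u : repr_tree d) : #|children u| = #|kids d (val (u : node d))|.
Proof.
rewrite -(card_imset _ (@val_inj _ _ (node d))); apply: eq_card => B.
rewrite [RHS]inE; apply/imsetP/idP => [[w wc ->]|uB].
  by move: wc; rewrite inE.
have [w defB] := nodeK dU X0 (child_ball dU (node_ball dU X0 u) uB).
by exists w; rewrite ?inE ?defB.
Qed.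

Lemma lev_le_last (A : {set X}) : A \in balls d ->
  (lev d A <= last_level (repr_tree d))%N.
Proof.
move=> /(nodeK dU X0)[u <-]; rewrite -levelE //.
exact: (leq_bigmax (F := fun v : repr_tree d => level v)).
Qed.

Lemma lev_inner_lt_last (A : {set X}) : A \in inners d ->
  (lev d A < last_level (repr_tree d))%N.
Proof.
move=> AI; have Ab := inner_ball dU AI.
have [B AB] := elimT (has_child dU Ab) AI.
by rewrite -(child_lev dU Ab AB) lev_le_last // (child_ball dU Ab AB).
Qed.

(** A node of maximal level has an ancestor on every earlier level, and proper ancestors are
    inner. *)
Lemma inner_at_level k : (k < last_level (repr_tree d))%N ->
  exists2 A, A \in inners d & lev d A = k.
Proof.
have [|v] := @bigop.eq_bigmax (vertex (repr_tree d)) (@level _).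
  by apply/card_gt0P; exists (root_node d).
rewrite -/(last_level _) levelE // => ->; have Ab := node_ball dU X0 v.
case/(ancestor dU Ab) => B [Bb AB <-]; exists B => //.
exact: proper_inner AB.
Qed.

(** By (A), distinct inner nodes share a level only on level [n - 1]. By [inner_at_level] this is
    the last level with inner nodes, so it can be described without [n]. *)
Lemma class_TP : class_T d <-> level_homogeneous d.
Proof.
split=> [[T1 T2] A B AI BI neqAB eq_lev|T].
  have [u defA] := nodeK dU X0 (inner_ball dU AI).
  have [v defB] := nodeK dU X0 (inner_ball dU BI).
  have uI : inner u by rewrite inner_inners // defA.
  have vI : inner v by rewrite inner_inners // defB.
  have neq_uv : u <> v by move=> uv; apply: neqAB; rewrite -defA -defB uv.
  have lu : level u = lev d A by rewrite levelE // defA.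
  have lv : level v = lev d A by rewrite levelE // defB.
  have levA := lev_inner_lt_last AI.
  have lastA : (lev d A).+1 = last_level (repr_tree d).
    move: levA; rewrite leq_eqVlt => /orP[/eqP //|/T1[w [_ uw]]].
    by case: neq_uv; rewrite -(uw u) // -(uw v).
  split; last by move=> C CI; rewrite -ltnS lastA; exact: lev_inner_lt_last.
  by rewrite -defA -defB -!card_children; apply: T2; rewrite ?lu ?lv.
split=> [k kn|u v]; last first.
  rewrite !inner_inners // !card_children => uI vI neq_uv lu lv.
  have neq_val : val (u : node d) <> val (v : node d) by move/val_inj.
  rewrite levelE // in lu; rewrite levelE // in lv.
  have eq_lev : lev d (val (u : node d)) = lev d (val (v : node d)).
    by apply: succn_inj; rewrite lu lv.
  by have [] := T _ _ uI vI neq_val eq_lev.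
have [A AI levA] := inner_at_level (ltnW kn).
have [u defA] := nodeK dU X0 (inner_ball dU AI).
exists u; split; first by rewrite inner_inners // levelE // defA.
move=> v [vI lv]; rewrite inner_inners // in vI; rewrite levelE // in lv.
apply/eqP/negP => /negP/eqP neq_uv.
have [C CI levC] := inner_at_level kn.
have neq_A : A <> val (v : node d) by rewrite -defA => /val_inj.
have [_ /(_ C CI)] := T _ _ AI vI neq_A (etrans levA (esym lv)).
by rewrite levC levA ltnn.
Qed.

End Classes.

(** * Isomorphisms of representing trees *)

Lemma rooted_iso_level (T1 T2 : rooted_graph) (f : T1 -> T2) :
  bijective f -> (forall u v, adj u v = adj (f u) (f v)) ->
  f (Defs.root T1) = Defs.root T2 -> forall v, level (f v) = level v.
Proof.
move=> f_bij f_adj f_root v; rewrite /level (bij_eq_card f_bij).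
apply: eq_find => k; have [g fK gK] := f_bij.
have path_map x s : path (@adj T2) (f x) (map f s) = path (@adj T1) x s.
  by elim: s x => //= y s IHs x; rewrite IHs f_adj.
apply/existsP/existsP => -[p /andP[pp /eqP lp]].
  exists (map_tuple g p); rewrite -path_map f_root /= mapK // pp /=.
  by rewrite -(inj_eq (can_inj fK)) -last_map f_root mapK // lp.
by exists (map_tuple f p); rewrite -f_root path_map pp /= last_map lp eqxx.
Qed.

Section TreeIso.
Variables (R : realType) (X Y : finType) (d : X -> X -> R) (e : Y -> Y -> R).

(** [F] acts on all sets of points rather than on the type of nodes; only its behaviour on balls is
    constrained. *)
Record tree_iso (F : {set X} -> {set Y}) : Prop := TreeIso {
  iso_image : F @: balls d = balls e;
  iso_inj : {in balls d &, injective F};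
  iso_lev : {in balls d, forall A, lev e (F A) = lev d A};
  iso_child : {in balls d &, forall A B, child e (F A) (F B) = child d A B}
}.

Hypothesis dU : is_ultrametric d.
Hypothesis eU : is_ultrametric e.

(** Both [lev] and [child] are determined by inclusion between balls. *)
Lemma tree_iso_subset (F : {set X} -> {set Y}) : F @: balls d = balls e ->
  {in balls d &, forall A B, (F A \subset F B) = (A \subset B)} -> tree_iso F.
Proof.
move=> imF subF.
have Fball A : A \in balls d -> F A \in balls e by move=> Ab; rewrite -imF imset_f.
have Finj : {in balls d &, injective F}.
  by move=> A B Ab Bb FAB; apply/eqP; rewrite finset.eqEsubset -!subF // FAB subxx.
have Fproper : {in balls d &, forall A B, (F A \proper F B) = (A \proper B)}.
  by move=> A B Ab Bb; rewrite !properE !subF.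
have Flev : {in balls d, forall A, lev e (F A) = lev d A}.
  move=> A Ab; rewrite /lev -(card_in_imset (f := F)); last first.
    by move=> B C; rewrite !inE => /andP[Bb _] /andP[Cb _]; exact: Finj.
  apply: eq_card => C; rewrite inE -imF.
  apply/andP/imsetP => [[/imsetP[B Bb ->]]|[B]].
    by rewrite Fproper // => AB; exists B; rewrite // inE Bb.
  by rewrite inE => /andP[Bb AB] ->; rewrite imset_f ?Fproper.
split=> // A B Ab Bb; rewrite !childE ?Fball //.
by rewrite Bb Fproper // !Flev.
Qed.

Section Theory.
Variable F : {set X} -> {set Y}.
Hypothesis Fiso : tree_iso F.

Lemma iso_ball (A : {set X}) : A \in balls d -> F A \in balls e.
Proof. by move=> Ab; rewrite -(iso_image Fiso) imset_f. Qed.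

Lemma iso_surj (B : {set Y}) : B \in balls e -> exists2 A, A \in balls d & F A = B.
Proof. by rewrite -(iso_image Fiso) => /imsetP[A Ab ->]; exists A. Qed.

Lemma iso_inner (A : {set X}) : A \in balls d -> (F A \in inners e) = (A \in inners d).
Proof.
move=> Ab; apply/(has_child eU (iso_ball Ab))/(has_child dU Ab) => -[B AB]; last first.
  by exists (F B); rewrite (iso_child Fiso) // (child_ball dU Ab AB).
have [C Cb defB] := iso_surj (child_ball eU (iso_ball Ab) AB).
by exists C; rewrite -(iso_child Fiso) // defB.
Qed.

Lemma iso_inner_surj (B : {set Y}) :
  B \in inners e -> exists2 A, A \in inners d & F A = B.
Proof.
move=> BI; have [A Ab FA] := iso_surj (inner_ball eU BI).
by exists A; rewrite // -iso_inner // FA.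
Qed.

Lemma iso_inners : F @: inners d = inners e.
Proof.
apply/setP => B; apply/imsetP/idP => [[A AI ->]|/iso_inner_surj[A AI <-]].
  by rewrite iso_inner // (inner_ball dU AI).
by exists A.
Qed.

Lemma card_inners : #|inners e| = #|inners d|.
Proof.
rewrite -iso_inners card_in_imset // => A B AI BI.
by apply: (iso_inj Fiso); exact: inner_ball.
Qed.

Lemma iso_kids (A : {set X}) : A \in balls d -> F @: kids d A = kids e (F A).
Proof.
move=> Ab; apply/setP => B; rewrite [RHS]inE.
apply/imsetP/idP => [[C]|AB].
  by rewrite inE => kAC ->; rewrite (iso_child Fiso) // (child_ball dU Ab kAC).
have [C Cb FC] := iso_surj (child_ball eU (iso_ball Ab) AB).
by exists C; rewrite // inE -(iso_child Fiso) // FC.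
Qed.

Lemma iso_card_kids (A : {set X}) : A \in balls d -> #|kids e (F A)| = #|kids d A|.
Proof.
move=> Ab; rewrite -iso_kids // card_in_imset // => B C.
by rewrite !inE => kAB kAC; apply: (iso_inj Fiso); exact: child_ball Ab _.
Qed.

Lemma iso_level_homogeneous : level_homogeneous d -> level_homogeneous e.
Proof.
move=> T _ _ /iso_inner_surj[A AI <-] /iso_inner_surj[B BI <-] neqFAB.
have [Ab Bb] := (inner_ball dU AI, inner_ball dU BI).
have neqAB : A <> B by move=> AB; rewrite AB in neqFAB.
rewrite !(iso_lev Fiso) // !iso_card_kids // => eq_lev.
have [-> levT] := T A B AI BI neqAB eq_lev; split=> // C.
by case/iso_inner_surj=> D DI <-; rewrite (iso_lev Fiso) ?levT ?(inner_ball dU).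
Qed.

End Theory.

Hypothesis X0 : (0 < #|X|)%N.
Hypothesis Y0 : (0 < #|Y|)%N.

Lemma rooted_iso_of_tree_iso F : tree_iso F -> rooted_iso (repr_tree d) (repr_tree e).
Proof.
move=> Fiso.
have FE (u : repr_tree d) : F (val (u : node d)) \in balls e.
  exact: iso_ball (node_ball dU X0 u).
pose f u := sval (nodeK eU Y0 (FE u)).
have fE u : val (f u : node e) = F (val (u : node d)) := svalP (nodeK eU Y0 (FE u)).
have f_inj : injective f.
  move=> u v /(congr1 (fun w : repr_tree e => val (w : node e))); rewrite !fE.
  by move=> /(iso_inj Fiso (node_ball dU X0 u) (node_ball dU X0 v)) /val_inj.
exists f; split.
- apply: inj_card_bij f_inj _; rewrite !card_repr_tree // -(iso_image Fiso).
  by rewrite card_in_imset //; exact: iso_inj.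
- move=> u v; rewrite /adj /= !fE !(iso_child Fiso) ?node_ball //.
- apply: val_inj; rewrite fE /=; apply/eqP/negPn/negP; rewrite -finset.properT.
  move/(lev_proper (setT_ball e Y0)).
  by rewrite (iso_lev Fiso) ?setT_ball // !lev_setT.
Qed.

(** A graph isomorphism ignores the direction of edges; fixing the root, it preserves levels, and
    these recover the direction. *)
Lemma tree_iso_of_rooted_iso :
  rooted_iso (repr_tree d) (repr_tree e) -> exists F, tree_iso F.
Proof.
case=> f [f_bij f_adj f_root].
have f_lev (u : repr_tree d) : lev e (val (f u : node e)) = lev d (val (u : node d)).
  by rewrite -!levelE // (rooted_iso_level f_bij f_adj f_root).
(* Sets that are not nodes get the arbitrary value [finset.set0]. *)
pose F A := if insub A is Some u then val (f u : node e) else finset.set0.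
have FE (u : repr_tree d) : F (val (u : node d)) = val (f u : node e).
  by rewrite /F valK.
exists F; split.
- apply/setP => B; apply/imsetP/idP => [[_ /(nodeK dU X0)[u <-] ->]|].
    by rewrite FE node_ball.
  case/(nodeK eU Y0)=> v <-; have [g fK gK] := f_bij.
  by exists (val (g v : node d)); rewrite ?node_ball // FE gK.
- move=> _ _ /(nodeK dU X0)[u <-] /(nodeK dU X0)[v <-]; rewrite !FE => /val_inj.
  by move=> /(bij_inj f_bij) ->.
- by move=> _ /(nodeK dU X0)[u <-]; rewrite FE f_lev.
- move=> _ _ /(nodeK dU X0)[u <-] /(nodeK dU X0)[v <-]; rewrite !FE.
  have childA (Z : finType) (c : Z -> Z -> R) (cU : is_ultrametric c)
      (Z0 : (0 < #|Z|)%N) (a b : repr_tree c) :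
      child c (val (a : node c)) (val (b : node c)) =
      adj a b && (lev c (val (b : node c)) == (lev c (val (a : node c))).+1).
    have [ab bb] := (node_ball cU Z0 a, node_ball cU Z0 b).
    apply/idP/andP => [H|[/orP[//|/(child_lev cU bb)->]]].
      by rewrite (child_lev cU ab H) eqxx /= H.
    (* If [a] were a child of [b], the level of [b] would exceed itself by two. *)
    by rewrite -[eqbLHS]addn0 -addn2 eqn_add2l.
  by rewrite !childA // f_adj !f_lev.
Qed.

End TreeIso.

(** * Weak similarities *)

Section WeakSimilarity.
Variables (R : realType) (X Y : finType) (d : X -> X -> R) (e : Y -> Y -> R).

(** For a bijection [Phi], this amounts to the existence of the scale function of a weak
    similarity. *)
Definition same_order (Phi : X -> Y) :=
  forall x y x' y', (e (Phi x) (Phi y) < e (Phi x') (Phi y')) = (d x y < d x' y').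

Lemma weakly_similarP :
  weakly_similar d e <-> exists2 Phi : X -> Y, bijective Phi & same_order Phi.
Proof.
split=> [[Phi [Phi_bij [f [_ f_mono fE]]]]|[Phi Phi_bij Phi_lt]].
  exists Phi => // x y x' y'; rewrite -!fE.
  have Sd u v : spectrum d (d u v) by exists u, v.
  case: (ltgtP (d x y) (d x' y')) => [lt_d|lt_d|->]; last by rewrite ltxx.
  - exact: f_mono.
  - by apply/negbTE; rewrite -leNgt ltW // f_mono.
exists Phi; split=> //.
have Phi_eq x y x' y' : d x y = d x' y' -> e (Phi x) (Phi y) = e (Phi x') (Phi y').
  move=> eq_d; apply/eqP; have := Phi_lt x y x' y'; have := Phi_lt x' y' x y.
  by rewrite eq_d ltxx; case: ltgtP.
(* [f] is read off any pair at distance [r]; [Phi_eq] makes the choice irrelevant, and 0 is a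
   default off the spectrum. *)
pose f r := if [pick p : X * X | r == d p.1 p.2] is Some p
            then e (Phi p.1) (Phi p.2) else 0.
have fE x y : f (d x y) = e (Phi x) (Phi y).
  rewrite /f; case: pickP => [[u v] /= /eqP/Phi_eq -> //|/(_ (x, y))].
  by rewrite eqxx.
exists f; split=> //; last by move=> _ _ [x [y ->]] [x' [y' ->]]; rewrite !fE Phi_lt.
split.
- by move=> _ [x [y ->]] /=; rewrite fE; exists (Phi x), (Phi y).
- move=> r s /set_mem[x [y ->]] /set_mem[x' [y' ->]]; rewrite !fE => eq_e.
  have := Phi_lt x y x' y'; have := Phi_lt x' y' x y.
  by rewrite eq_e ltxx; case: ltgtP.
- have [g _ gK] := Phi_bij; move=> _ [u [v ->]].
  by exists (d (g u) (g v)); [exists (g u), (g v)|rewrite fE !gK].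
Qed.

Hypothesis dU : is_ultrametric d.
Hypothesis eU : is_ultrametric e.
Variable Phi : X -> Y.
Hypothesis Phi_bij : bijective Phi.
Hypothesis Phi_lt : same_order Phi.

Lemma imset_ball x y : Phi @: ball d x y = ball e (Phi x) (Phi y).
Proof.
have [g gK Kg] := Phi_bij; apply/setP => z; rewrite -[z]Kg mem_imset ?inE.
  by rewrite !leNgt Phi_lt.
exact: bij_inj.
Qed.

Lemma imset_tree_iso : tree_iso d e (fun A => Phi @: A).
Proof.
have [g gK Kg] := Phi_bij; apply: tree_iso_subset => //.
  apply/setP => B; apply/imsetP/idP => [[_ /ballP[x [y ->]] ->]|].
    by rewrite imset_ball mem_balls.
  case/ballP=> u [v ->]; exists (ball d (g u) (g v)); first exact: mem_balls.
  by rewrite imset_ball !Kg.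
move=> A B _ _; apply/fintype.subsetP/fintype.subsetP => AB x.
  by move=> xA; rewrite -(mem_imset _ _ (bij_inj Phi_bij)) AB // imset_f.
by case/imsetP=> z zA ->; rewrite imset_f ?AB.
Qed.

Lemma imset_diam_lt (A B : {set X}) : A \in balls d -> B \in balls d ->
  (diam e (Phi @: A) < diam e (Phi @: B)) = (diam d A < diam d B).
Proof.
move=> /ballP[x [y ->]] /ballP[x' [y' ->]].
by rewrite !imset_ball !diam_ball.
Qed.

Lemma imset_rank (A : {set X}) : A \in balls d -> rank e (Phi @: A) = rank d A.
Proof.
move=> Ab; rewrite /rank -(card_imset _ (imset_inj (bij_inj Phi_bij))).
apply: eq_card => C; rewrite inE; apply/andP/imsetP => [[]|[B]].
  case/(iso_inner_surj dU eU imset_tree_iso) => B BI <-.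
  by rewrite imset_diam_lt // ?(inner_ball dU BI) // => AB; exists B; rewrite // inE BI.
rewrite inE => /andP[BI AB] ->; have Bb := inner_ball dU BI.
by rewrite (iso_inner dU eU imset_tree_iso) // BI imset_diam_lt.
Qed.

End WeakSimilarity.

(** * Changing the labels *)

Section Relabel.
Variables (R : realType) (X : finType) (d : X -> X -> R).
Hypothesis dU : is_ultrametric d.
Hypothesis X0 : (0 < #|X|)%N.
Hypothesis dI : {in inners d &, injective (diam d)}.
Variable h : {set X} -> nat.
Hypothesis h_mono :
  {in balls d &, forall A B : {set X}, A \subset B -> (h A <= h B)%N}.

(** The label of the node [ball d x y] is shifted by a multiple of its [h]-value. The factor exceeds
    every distance, so [h] decides the order of labels and [d] breaks ties. The case [x == y] is
    separate because [h] may be positive on singletons. *)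
Definition relabel (x y : X) : R :=
  if x == y then 0 else d x y + (diam d [set: X]%SET + 1) * (h (ball d x y))%:R.

Lemma dist_le_diam x y : d x y <= diam d [set: X]%SET.
Proof. by rewrite -(ball_centerE dU _ (setT_ball d X0)) finset.in_setT. Qed.

Lemma step_ge0 : 0 <= diam d [set: X]%SET + 1.
Proof.
have [x _] := card_gt0P X0; rewrite addr_ge0 //.
by rewrite (le_trans (ultra_ge0 dU x x)) // dist_le_diam.
Qed.

Lemma relabel_gt0 x y : (0 < relabel x y) = (x != y).
Proof.
rewrite /relabel; case: eqVneq => [_|xy]; first by rewrite ltxx.
by rewrite ltr_wpDr ?mulr_ge0 ?step_ge0 ?ler0n // dist_gt0.
Qed.

Lemma relabel_lt x y z : d x y < d x z -> relabel x y < relabel x z.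
Proof.
move=> lt_yz; have xz : x != z by rewrite -(dist_gt0 dU) (le_lt_trans _ lt_yz) ?ultra_ge0.
have [<-|xy] := eqVneq x y; first by rewrite {1}/relabel eqxx relabel_gt0.
rewrite /relabel (negbTE xy) (negbTE xz) ltr_leD // ler_wpM2l ?step_ge0 //.
rewrite ler_nat h_mono ?mem_balls //.
by rewrite (ball_subE dU (x := x)) ?mem_balls ?mem_balll // !diam_ball // ltW.
Qed.

Lemma ball_eq_dist x y z : d x y = d x z -> ball d x y = ball d x z.
Proof. by move=> yz; apply/setP => t; rewrite !inE yz. Qed.

(** Seen from a fixed point the order of distances is unchanged; this yields the ultrametric
    inequality and the same balls. *)
Lemma relabel_le x y z : (relabel x y <= relabel x z) = (d x y <= d x z).
Proof.
apply/idP/idP => [|le_yz]; first by apply: contraTT; rewrite -!ltNge => /relabel_lt.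
move: le_yz; rewrite le_eqVlt => /orP[/eqP yz|/relabel_lt/ltW //].
rewrite /relabel (ball_eq_dist yz) yz.
suff -> : (x == y) = (x == z) by [].
by apply: negb_inj; rewrite -!(dist_gt0 dU) yz.
Qed.

Lemma ball_sym x y : ball d x y = ball d y x.
Proof.
apply: ball_eq; rewrite ?mem_balls ?mem_ballr // diam_ball //.
exact: (ultra_sym dU).
Qed.

Lemma relabel_sym x y : relabel x y = relabel y x.
Proof. by rewrite /relabel eq_sym ball_sym (ultra_sym dU). Qed.

Lemma relabel_ultrametric : is_ultrametric relabel.
Proof.
have ge0 x y : 0 <= relabel x y.
  have [->|xy] := eqVneq x y; first by rewrite /relabel eqxx.
  by rewrite ltW // relabel_gt0.
split=> //; first exact: relabel_sym.
- move=> x y; split=> [xy0|->]; last by rewrite /relabel eqxx.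
  by apply/eqP/negPn; rewrite -relabel_gt0 xy0 ltxx.
- move=> x y z; rewrite le_max.
  have /orP[] : (d x y <= d x z) || (d x y <= d z y).
  + by rewrite -le_max; exact: ultra_triangle.
  + by rewrite relabel_le => ->.
  + rewrite (ultra_sym dU x) (ultra_sym dU z) -relabel_le relabel_sym.
    by rewrite (relabel_sym y z) => ->; rewrite orbT.
Qed.

Lemma ball_relabel x y : ball relabel x y = ball d x y.
Proof. by apply/setP => z; rewrite !inE relabel_le. Qed.

Lemma balls_relabel : balls relabel = balls d.
Proof.
apply/setP => A; apply/ballP/ballP => -[x [y ->]]; exists x, y.
  exact: ball_relabel.
by rewrite ball_relabel.
Qed.

Lemma inners_relabel : inners relabel = inners d.
Proof. by rewrite /inners balls_relabel. Qed.

Lemma lev_relabel A : lev relabel A = lev d A.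
Proof. by rewrite /lev balls_relabel. Qed.

Lemma diam_relabel (A : {set X}) : A \in inners d ->
  diam relabel A = diam d A + (diam d [set: X]%SET + 1) * (h A)%:R.
Proof.
case/(inner_ballP dU) => x [y [xy ->]]; rewrite -{1}ball_relabel.
by rewrite (diam_ball relabel_ultrametric) diam_ball // /relabel (negbTE xy).
Qed.

Lemma diam_relabel_lt (A B : {set X}) : A \in inners d -> B \in inners d ->
  (h A < h B)%N -> diam relabel A < diam relabel B.
Proof.
move=> AI BI hAB; rewrite !diam_relabel //.
have [a [a' [_ defA]]] := inner_ballP dU _ AI; have [_ B0] := innerP dU _ BI.
have lt_A : diam d A < diam d B + (diam d [set: X]%SET + 1).
  rewrite defA diam_ball // ltr_pwDl // (le_trans (dist_le_diam _ _)) //.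
  by rewrite lerDl.
(* One extra unit of [h] adds more than any difference of old labels. *)
apply: lt_le_trans (_ : diam d B + (diam d [set: X]%SET + 1) * (h A).+1%:R <= _).
  by rewrite mulrSr mulrDr mulr1 (addrC (diam d A)) addrCA ltrD2l.
by rewrite lerD2l ler_wpM2l ?step_ge0 // ler_nat.
Qed.

Lemma relabel_injective : {in inners relabel &, injective (diam relabel)}.
Proof.
rewrite inners_relabel => A B AI BI eqAB.
case: (ltngtP (h A) (h B)) => [hAB|hBA|hAB].
- by have := diam_relabel_lt AI BI hAB; rewrite eqAB ltxx.
- by have := diam_relabel_lt BI AI hBA; rewrite eqAB ltxx.
- by apply: dI => //; move: eqAB; rewrite !diam_relabel // hAB => /addIr.
Qed.

Lemma relabel_tree_iso : tree_iso d relabel id.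
Proof.
apply: tree_iso_subset => //; first exact: relabel_ultrametric.
by rewrite balls_relabel imset_id.
Qed.

End Relabel.

(** * Ranks of inner nodes *)

Section Rank.
Variables (R : realType) (X : finType) (d : X -> X -> R).
Hypothesis dU : is_ultrametric d.

Lemma rank_lt (A B : {set X}) : B \in inners d ->
  diam d A < diam d B -> (rank d B < rank d A)%N.
Proof.
move=> BI AB; apply/proper_card/properP; split.
  apply/fintype.subsetP => C; rewrite !inE => /andP[-> BC].
  exact: lt_trans BC.
by exists B; rewrite inE ?BI ?AB // ltxx andbF.
Qed.

Hypothesis dI : {in inners d &, injective (diam d)}.

Lemma rank_ltE (A B : {set X}) : A \in inners d -> B \in inners d ->
  (rank d A < rank d B)%N = (diam d B < diam d A).
Proof.
move=> AI BI; case: (ltgtP (diam d B) (diam d A)) => [|/(rank_lt BI)|/dI ->//].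
- exact: rank_lt.
- by move=> BA; apply/negbTE; rewrite -leqNgt ltnW.
- by rewrite ltnn.
Qed.

Lemma rank_inj : {in inners d &, injective (rank d)}.
Proof.
move=> A B AI BI eqAB; apply: dI => //; apply/eqP.
by have := rank_ltE AI BI; have := rank_ltE BI AI; rewrite eqAB ltnn; case: ltgtP.
Qed.

Lemma lev_le_rank (A : {set X}) : A \in balls d -> (lev d A <= rank d A)%N.
Proof.
move=> Ab; apply/subset_leq_card/fintype.subsetP => B; rewrite inE => /andP[Bb AB].
by rewrite inE (proper_inner dU Ab Bb AB) diam_proper.
Qed.

End Rank.

(** * Necessity: (i) implies (ii) *)

Section Necessity.
Variables (R : realType) (X : finType) (d : X -> X -> R).
Hypothesis dU : is_ultrametric d.
Hypothesis X0 : (0 < #|X|)%N.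
Hypothesis dI : {in inners d &, injective (diam d)}.
Hypothesis similar : forall (Y : finType) (e : Y -> Y -> R),
  (0 < #|Y|)%N -> is_ultrametric e -> class_D e ->
  rooted_iso (repr_tree d) (repr_tree e) -> weakly_similar d e.

(** Statement (i) is applied to the relabelled metric on the same points, where [id] is an
    isomorphism of trees. [F] takes images under the resulting weak similarity. *)
Lemma relabel_similar (h : {set X} -> nat) :
  {in balls d &, forall A B : {set X}, A \subset B -> (h A <= h B)%N} ->
  exists2 F : {set X} -> {set X}, F @: inners d = inners d &
    {in inners d, forall A, [/\ lev d (F A) = lev d A, #|kids d (F A)| = #|kids d A|
                              & rank (relabel d h) (F A) = rank d A]}.
Proof.
move=> h_mono; set e := relabel d h.
have eU : is_ultrametric e := relabel_ultrametric dU X0 h_mono.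
have id_iso : tree_iso d e id := relabel_tree_iso dU X0 h_mono.
have [|Phi Phi_bij Phi_lt] := (weakly_similarP d e).1.
  apply: similar => //; first exact/(class_DP eU X0)/relabel_injective.
  exact: rooted_iso_of_tree_iso id_iso.
have F_iso := imset_tree_iso dU eU Phi_bij Phi_lt.
exists (fun A : {set X} => Phi @: A).
  by rewrite (iso_inners dU eU F_iso) inners_relabel.
move=> A AI; have Ab := inner_ball dU AI.
have FAb : Phi @: A \in balls d.
  by have := iso_ball F_iso Ab; rewrite balls_relabel.
split; last exact: imset_rank.
- by rewrite -(lev_relabel dU X0 h_mono) (iso_lev F_iso).
- by rewrite -(iso_card_kids dU eU id_iso) // (iso_card_kids dU eU F_iso).
Qed.

(* The relabelling that puts the chain from the root to [A] before all the other
   inner nodes gives [A] the rank [lev d A]. *)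
Lemma rank_chain_first (A : {set X}) : A \in inners d ->
  exists2 B, B \in inners d &
    [/\ lev d B = lev d A, #|kids d B| = #|kids d A| & rank d B = lev d A].
Proof.
move=> AI; pose h (B : {set X}) : nat := A \subset B.
have h_mono : {in balls d &, forall B C : {set X}, B \subset C -> (h B <= h C)%N}.
  move=> B C _ _ BC; rewrite /h; case: (boolP (A \subset B)) => // AB.
  by rewrite (fintype.subset_trans AB BC).
have [F F_im F_prop] := relabel_similar h_mono.
have [B BI FB] : exists2 B, B \in inners d & F B = A.
  by have := AI; rewrite -{1}F_im => /imsetP[B BI ->]; exists B.
exists B => //; have [<- <- <-] := F_prop B BI; rewrite FB; split=> //.
have eU := relabel_ultrametric dU X0 h_mono.
(* Only proper ancestors of [A] have a larger new label: a node not containing [A] has [h] equal to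
   0, below the value 1 at [A]. *)
apply: eq_card => C; rewrite !inE balls_relabel // -andbA.
apply/and3P/andP => [[Cb C1 lt_AC]|[Cb pAC]].
  have CI : C \in inners d by rewrite inE Cb.
  split=> //; rewrite finset.properEneq; apply/andP; split.
    by apply: contraTneq lt_AC => ->; rewrite ltxx.
  apply: contraTT lt_AC => nAC; rewrite -leNgt ltW //.
  by apply: (diam_relabel_lt dU X0 h_mono); rewrite // /h (negbTE nAC) subxx.
have CI := proper_inner dU (inner_ball dU AI) Cb pAC.
split=> //; first by move: CI; rewrite inE => /andP[].
by apply: (diam_proper eU); rewrite // balls_relabel // inner_ball.
Qed.

(* The relabelling that lists the inner nodes level by level. *)
Lemma rank_breadth_first (A B C : {set X}) : A \in inners d -> B \in inners d ->
  A <> B -> lev d A = lev d B -> C \in inners d -> (lev d A < lev d C)%N ->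
  (lev d C < rank d C)%N.
Proof.
move=> AI BI neqAB eq_lev CI ltAC.
(* [h] decreases as the level grows; the subtraction never truncates, since [lev] is at most the
   number of balls. *)
pose h (D : {set X}) : nat := (#|balls d| - lev d D)%N.
have h_mono : {in balls d &, forall D E : {set X}, D \subset E -> (h D <= h E)%N}.
  by move=> D E _ _ DE; rewrite leq_sub2l ?lev_sub.
have [F F_im F_prop] := relabel_similar h_mono.
have FI : F C \in inners d by rewrite -F_im imset_f.
(* The claim moves to the image [F C] and its rank among the new labels. *)
have [<- _ <-] := F_prop C CI; have levFC : lev d (F C) = lev d C by case: (F_prop C CI).
rewrite -levFC in ltAC; move: (F C) FI ltAC => {levFC CI} {}C CI ltAC.
have Cb := inner_ball dU CI.
have lt_label D : D \in inners d -> (lev d D < lev d C)%N ->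
    diam (relabel d h) C < diam (relabel d h) D.
  move=> DI ltDC; apply: (diam_relabel_lt dU X0 h_mono) => //.
  have lev_le (E : {set X}) : (lev d E <= #|balls d|)%N.
    by apply/subset_leq_card/fintype.subsetP => G; rewrite inE => /andP[].
  by rewrite ltn_sub2l // (leq_trans ltDC).
(* The distinct nodes [A] and [B] of one level cannot both be ancestors of [C]; one that is not
   serves as [D], which adds to the rank but not to the level. *)
have [D DI /andP[ltDC nCD]] :
    exists2 D, D \in inners d & (lev d D < lev d C)%N && ~~ (C \proper D).
  have [AC|nCA] := boolP (C \proper A); last by exists A => //; rewrite ltAC.
  exists B => //; rewrite -eq_lev ltAC; apply/negP => CB; apply: neqAB.
  have [x xC] := ball_neq0 dU Cb.
  have xP (E : {set X}) : C \proper E -> x \in E.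
    by move/proper_sub/fintype.subsetP; apply.
  have [Ab Bb] := (inner_ball dU AI, inner_ball dU BI).
  have [sAB|/(lev_proper Ab)] := nested dU Ab Bb (xP _ AC) (xP _ CB); last first.
    by rewrite eq_lev ltnn.
  apply/eqP; rewrite finset.eqEproper sAB; apply/negP => /(lev_proper Bb).
  by rewrite eq_lev ltnn.
apply/proper_card/properP; split.
  apply/fintype.subsetP => E; rewrite !inE balls_relabel // => /andP[Eb CE].
  have EI := proper_inner dU Cb Eb CE.
  by rewrite Eb lt_label ?lev_proper // andbT; move: EI; rewrite inE => /andP[].
exists D; last by rewrite inE negb_and nCD orbT.
by rewrite inE inners_relabel // DI lt_label.
Qed.

Lemma homogeneous_of_similar : level_homogeneous d.
Proof.
move=> A B AI BI neqAB eq_lev.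
(* [A'] and [B'] both have rank [lev d A], so they coincide. *)
have [A' A'I [_ <- rkA]] := rank_chain_first AI.
have [B' B'I [_ <- rkB]] := rank_chain_first BI.
split; first by rewrite (rank_inj dI A'I B'I) // rkA rkB.
move=> C CI; rewrite leqNgt; apply/negP => ltAC.
have [D DI [levD _ rkD]] := rank_chain_first CI.
have := rank_breadth_first AI BI neqAB eq_lev DI; rewrite levD rkD ltnn.
by move/(_ ltAC).
Qed.

End Necessity.

(** * Spaces of the class T *)

(** Fibres of equal size are matched in enumeration order; [tr] with the two sides exchanged is the
    inverse. [x0] and [y0] are only defaults of [nth]. *)
Lemma fiber_bijection (X Y : finType) (T : eqType) (f : X -> T) (g : Y -> T) :
  (0 < #|X|)%N -> (0 < #|Y|)%N ->
  (forall r, #|[set x | f x == r]%SET| = #|[set y | g y == r]%SET|) ->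
  exists2 Phi : X -> Y, bijective Phi & forall x, g (Phi x) = f x.
Proof.
move=> /card_gt0P[x0 _] /card_gt0P[y0 _].
pose fib (Z : finType) (c : Z -> T) r := enum [set z | c z == r]%SET.
pose tr (U V : finType) (v0 : V) (a : U -> T) (b : V -> T) u :=
  nth v0 (fib V b (a u)) (index u (fib U a (a u))).
have trP (U V : finType) (u0 : U) (v0 : V) (a : U -> T) (b : V -> T) :
    (forall r, #|[set u | a u == r]%SET| = #|[set v | b v == r]%SET|) ->
    forall u, b (tr U V v0 a b u) = a u /\ tr V U u0 b a (tr U V v0 a b u) = u.
  move=> card_eq u.
  have u_in : u \in fib U a (a u) by rewrite mem_enum inE.
  have i_lt : (index u (fib U a (a u)) < size (fib V b (a u)))%N.
    by rewrite -cardE -card_eq cardE index_mem.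
  have btr : b (tr U V v0 a b u) = a u.
    by apply/eqP; have := mem_nth v0 i_lt; rewrite mem_enum inE.
  by split=> //; rewrite /tr -/(tr U V v0 a b u) btr index_uniq ?enum_uniq ?nth_index.
move=> card_eq; exists (tr X Y y0 f g) => [|x]; last first.
  by have [] := trP X Y x0 y0 f g card_eq x.
exists (tr Y X x0 g f) => [x|y].
  by have [] := trP X Y x0 y0 f g card_eq x.
by have [] := trP Y X y0 x0 g f (fun r => esym (card_eq r)) y.
Qed.

Section Homogeneous.
Variables (R : realType) (X : finType) (d : X -> X -> R).
Hypothesis dU : is_ultrametric d.
Hypothesis X0 : (0 < #|X|)%N.
Hypothesis dI : {in inners d &, injective (diam d)}.

Lemma rank_lt_card (A : {set X}) : A \in inners d -> (rank d A < #|inners d|)%N.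
Proof.
move=> AI; apply/proper_card/properP; split.
  by apply/fintype.subsetP => B; rewrite inE => /andP[].
by exists A; rewrite // inE ltxx andbF.
Qed.

(** The ranks of inner nodes are distinct and smaller than their number, so they fill the
    interval. *)
Lemma rank_surj r :
  (r < #|inners d|)%N -> exists2 A, A \in inners d & rank d A = r.
Proof.
move=> rN; pose s := [seq rank d A | A <- enum (inners d)].
have s_uniq : uniq s.
  rewrite map_inj_in_uniq ?enum_uniq // => A B; rewrite !mem_enum.
  exact: rank_inj.
have [||_ s_eq] := @uniq_min_size _ s (iota 0 #|inners d|) s_uniq.
- by move=> _ /mapP[A + ->]; rewrite mem_enum mem_iota => /rank_lt_card.
- by rewrite size_iota size_map cardE.
have : r \in s by rewrite s_eq mem_iota.
by case/mapP=> A; rewrite mem_enum => AI ->; exists A.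
Qed.

Definition leaves (A : {set X}) : {set X} := [set x | child d A [set x]%SET]%SET.

Lemma card_leaves (A : {set X}) :
  A \in balls d -> #|leaves A| = #|kids d A :\: inners d|.
Proof.
move=> Ab; rewrite -(card_imset _ (@finset.set1_inj X)).
apply: eq_card => B; rewrite !inE; apply/imsetP/andP => [[x]|[BI AB]].
  by rewrite inE => Ax ->; rewrite cards1 andbF.
have Bb := child_ball dU Ab AB; have [x xB] := ball_neq0 dU Bb.
have : (#|B| <= 1)%N by rewrite leqNgt; move: BI; rewrite Bb.
rewrite leq_eqVlt ltnS leqn0 cards_eq0 => /orP[/cards1P[y defB]|/eqP B0].
  by exists y; rewrite // inE -defB.
by rewrite B0 inE in xB.
Qed.

Hypothesis X1 : (1 < #|X|)%N.

Lemma leaf_parent_exists x :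
  exists A : {set X}, (A \in inners d) && child d A [set x]%SET.
Proof.
have xb : [set x]%SET \in balls d by rewrite -(ball_xx dU) mem_balls.
have [|A Ab Ax] := parent_exists dU xb (setT_ball d X0).
  by rewrite finset.properT; apply: contraTneq X1 => xT; rewrite -cardsT -xT cards1.
by exists A; rewrite Ax andbT; apply/has_child; eauto.
Qed.

Definition leaf_parent x : {set X} := xchoose (leaf_parent_exists x).

Lemma leaf_parent_inner x : leaf_parent x \in inners d.
Proof. by have /andP[] := xchooseP (leaf_parent_exists x). Qed.

Lemma leaf_parent_child x : child d (leaf_parent x) [set x]%SET.
Proof. by have /andP[] := xchooseP (leaf_parent_exists x). Qed.

Lemma leaf_parentE x (A : {set X}) :
  A \in inners d -> (leaf_parent x == A) = (x \in leaves A).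
Proof.
move=> AI; rewrite inE; apply/eqP/idP => [<-|]; first exact: leaf_parent_child.
have Pb := inner_ball dU (leaf_parent_inner x).
exact: parent_unique Pb (inner_ball dU AI) (leaf_parent_child x).
Qed.

(** The parent of a leaf is the smallest inner node containing its point: a smaller one would lie
    strictly between parent and child. *)
Lemma mem_leaf_parent x (A : {set X}) :
  A \in inners d -> (x \in A) = (leaf_parent x \subset A).
Proof.
move=> AI; have Ab := inner_ball dU AI.
have Pb := inner_ball dU (leaf_parent_inner x).
have Px := leaf_parent_child x.
have xP : x \in leaf_parent x.
  by rewrite -finset.sub1set proper_sub // (child_proper dU Pb).
apply/idP/idP => [xA|/fintype.subsetP/(_ _ xP) //].
have [//|pAP] := nested dU Pb Ab xP xA.
have := lev_proper Ab (_ : [set x]%SET \proper A).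
rewrite (child_lev dU Pb Px) ltnS leqNgt lev_proper // => /(_ _)/negP; case => //.
rewrite finset.properEneq finset.sub1set xA andbT.
by apply: contraTneq AI => <-; rewrite inE cards1 andbF.
Qed.

Hypothesis dT : level_homogeneous d.

(** The ancestor of [A] on the level of [B] must be [B]: otherwise that level would be the last with
    inner nodes, while [A] lies deeper. *)
Lemma homogeneous_proper (A B : {set X}) : A \in inners d -> B \in inners d ->
  (A \proper B) = (lev d B < lev d A)%N.
Proof.
move=> AI BI; have [Ab Bb] := (inner_ball dU AI, inner_ball dU BI).
apply/idP/idP => [|ltBA]; first exact: lev_proper.
have [C [Cb pAC levC]] := ancestor dU Ab ltBA.
have [<- //|/eqP neqCB] := eqVneq C B.
have [_ /(_ A AI)] := dT (proper_inner dU Ab Cb pAC) BI neqCB levC.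
by rewrite levC leqNgt ltBA.
Qed.

Lemma homogeneous_subset (A B : {set X}) : A \in inners d -> B \in inners d ->
  (A \subset B) = (rank d A == rank d B) || (lev d B < lev d A)%N.
Proof.
move=> AI BI; rewrite finset.subEproper homogeneous_proper //.
by congr (_ || _); apply/eqP/eqP => [->//|/(rank_inj dI AI BI)].
Qed.

(* An inner node either is preceded by its ancestors only, so that its rank is
   its level, or lies on the last level that contains inner nodes. *)
Lemma lev_le_of_rank (A C : {set X}) : A \in inners d -> C \in inners d ->
  (lev d C <= rank d A)%N -> (lev d C <= lev d A)%N.
Proof.
move=> AI CI leCA; have [/(leq_trans leCA) //|ltA] := leqP (rank d A) (lev d A).
(* The rank exceeds the number of ancestors, so some inner non-ancestor [B] has a larger label. It
   can only lie on the level of [A], which is then the last with inner nodes. *)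
have [B] : exists2 B, B \in [set B in inners d | diam d A < diam d B]%SET
                    & B \notin [set B in balls d | A \proper B]%SET.
  by apply/subsetPn; apply: contraL ltA => /subset_leq_card; rewrite -leqNgt.
rewrite !inE => /andP[/andP[Bb B1] ltAB]; rewrite Bb /= => nAB.
have BI : B \in inners d by rewrite inE Bb.
case: (ltngtP (lev d A) (lev d B)) => [|ltBA|eq_lev].
- rewrite -homogeneous_proper // => /(diam_proper dU Bb (inner_ball dU AI)).
  by rewrite ltNge ltW.
- by rewrite homogeneous_proper // ltBA in nAB.
have neqAB : A <> B by move=> AB; rewrite AB ltxx in ltAB.
by have [_ ->] := dT AI BI neqAB eq_lev.
Qed.

(** A level with two inner nodes is the last one with inner nodes, so all children of its inner
    nodes are leaves. *)
Lemma card_leaves_lev (A B : {set X}) : A \in inners d -> B \in inners d ->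
  lev d A = lev d B -> #|leaves A| = #|leaves B|.
Proof.
move=> AI BI eq_lev; have [->//|/eqP neqAB] := eqVneq A B.
have [eq_kids last_lev] := dT AI BI neqAB eq_lev.
have leaf_kids C : C \in inners d -> lev d C = lev d A -> #|leaves C| = #|kids d C|.
  move=> CI levC; have Cb := inner_ball dU CI; rewrite card_leaves //.
  apply: eq_card => D; rewrite inE andb_idl // inE => CD.
  by apply/negP => /last_lev; rewrite (child_lev dU Cb CD) levC ltnn.
by rewrite !leaf_kids.
Qed.

End Homogeneous.

(** * Sufficiency: (ii) implies (i) *)

Section Sufficiency.
Variables (R : realType) (X Y : finType) (d : X -> X -> R) (e : Y -> Y -> R).
Hypothesis dU : is_ultrametric d.
Hypothesis eU : is_ultrametric e.
Hypothesis X0 : (0 < #|X|)%N.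
Hypothesis Y0 : (0 < #|Y|)%N.
Hypothesis dI : {in inners d &, injective (diam d)}.
Hypothesis eI : {in inners e &, injective (diam e)}.
Variable F : {set X} -> {set Y}.
Hypothesis Fiso : tree_iso d e F.
Hypothesis dT : level_homogeneous d.

Let eT : level_homogeneous e := iso_level_homogeneous dU eU Fiso dT.

Lemma setT_inner : ([set: X]%SET \in inners d) = (1 < #|X|)%N.
Proof. by rewrite inE setT_ball // cardsT. Qed.

(** [lev_le_of_rank] compares nodes of one space, so [A] is transported to [Y] by [F], and [B] is
    pulled back to [X] for the other inequality. *)
Lemma matched_lev (A : {set X}) (B : {set Y}) : A \in inners d -> B \in inners e ->
  rank d A = rank e B -> lev d A = lev e B.
Proof.
move=> AI BI eq_rank; have [Ab Bb] := (inner_ball dU AI, inner_ball eU BI).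
apply/eqP; rewrite eqn_leq; apply/andP; split.
  rewrite -(iso_lev Fiso Ab); apply: lev_le_of_rank => //.
    by rewrite (iso_inner dU eU Fiso).
  by rewrite (iso_lev Fiso) // -eq_rank lev_le_rank.
have [C CI defB] := iso_inner_surj dU eU Fiso BI; have Cb := inner_ball dU CI.
rewrite -defB (iso_lev Fiso Cb); apply: lev_le_of_rank => //.
by rewrite -(iso_lev Fiso Cb) defB eq_rank lev_le_rank.
Qed.

Lemma iso_card_leaves (A : {set X}) :
  A \in balls d -> #|leaves e (F A)| = #|leaves d A|.
Proof.
move=> Ab; rewrite !card_leaves ?(iso_ball Fiso) //.
rewrite -(card_in_imset (f := F)) => [|B C]; last first.
  rewrite !inE => /andP[_ kAB] /andP[_ kAC].
  by apply: (iso_inj Fiso); exact: child_ball Ab _.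
apply: eq_card => B; rewrite inE -(iso_kids dU eU Fiso Ab).
apply/andP/imsetP => [[BI /imsetP[C kAC defB]]|[C]].
  have Cb : C \in balls d by move: kAC; rewrite inE; exact: child_ball.
  by exists C; rewrite // inE kAC andbT -(iso_inner dU eU Fiso) // -defB.
rewrite inE => /andP[nCI kAC] ->; rewrite imset_f //.
have Cb : C \in balls d by move: kAC; rewrite inE; exact: child_ball.
by rewrite (iso_inner dU eU Fiso).
Qed.

(** [F A] may differ from [B], but both lie on the same level of [Y]. *)
Lemma matched_leaves (A : {set X}) (B : {set Y}) : A \in inners d -> B \in inners e ->
  rank d A = rank e B -> #|leaves d A| = #|leaves e B|.
Proof.
move=> AI BI eq_rank; have Ab := inner_ball dU AI.
rewrite -iso_card_leaves //; apply: card_leaves_lev => //.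
  by rewrite (iso_inner dU eU Fiso).
by rewrite (iso_lev Fiso) //; exact: matched_lev.
Qed.

Lemma matched_exists (A : {set X}) :
  A \in inners d -> exists2 B, B \in inners e & rank d A = rank e B.
Proof.
move=> AI; have [|B BI <-] := @rank_surj _ _ e eI (rank d A); last by exists B.
by rewrite (card_inners dU eU Fiso) rank_lt_card.
Qed.

Lemma matched_exists_inv (B : {set Y}) :
  B \in inners e -> exists2 A, A \in inners d & rank d A = rank e B.
Proof.
move=> BI; apply: rank_surj => //.
by rewrite -(card_inners dU eU Fiso) rank_lt_card.
Qed.

Lemma matched_subset (A A' : {set X}) (B B' : {set Y}) :
  A \in inners d -> A' \in inners d -> B \in inners e -> B' \in inners e ->
  rank d A = rank e B -> rank d A' = rank e B' -> (A \subset A') = (B \subset B').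
Proof.
move=> AI A'I BI B'I rkA rkA'; rewrite (homogeneous_subset dU dI dT) //.
rewrite (homogeneous_subset eU eI eT) // rkA rkA'.
by rewrite (matched_lev AI BI rkA) (matched_lev A'I B'I rkA').
Qed.

Lemma weakly_similar_of_tree_iso : weakly_similar d e.
Proof.
apply/weakly_similarP; have [X1|X1] := ltnP 1 #|X|; last first.
  have Y1 : (#|Y| <= 1)%N.
    rewrite leqNgt; apply: contraL X1 => Y1; rewrite -ltnNge -setT_inner.
    have TI : [set: Y]%SET \in inners e by rewrite inE setT_ball // cardsT.
    have [A AI _] := iso_inner_surj dU eU Fiso TI.
    move: AI; rewrite !inE setT_ball // => /andP[_ A1].
    by rewrite cardsT (leq_trans A1) // max_card.
  have [[x0 _] [y0 _]] := (card_gt0P X0, card_gt0P Y0).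
  exists (fun=> y0) => [|x y x' y'].
    by exists (fun=> x0) => z; apply: (fintype_le1P _ _ _).
  rewrite ltxx; have [-> ->] : x = x' /\ y = y'.
    by split; apply: (fintype_le1P _ _ _).
  by rewrite ltxx.
have Y1 : (1 < #|Y|)%N.
  have TI : [set: X]%SET \in inners d by rewrite setT_inner.
  have := iso_inner dU eU Fiso (setT_ball d X0); rewrite TI inE => /andP[_].
  by move/leq_trans; apply; exact: max_card.
pose P := leaf_parent dU X0 X1; pose Q := leaf_parent eU Y0 Y1.
have PI x : P x \in inners d := leaf_parent_inner dU X0 X1 x.
have QI y : Q y \in inners e := leaf_parent_inner eU Y0 Y1 y.
(* [Phi] is any bijection that preserves the rank of the parent of each point. *)
have [|Phi Phi_bij PhiE] := fiber_bijection (f := rank d \o P) (g := rank e \o Q) X0 Y0.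
  move=> r.
  have fibd A : A \in inners d -> rank d A = r ->
      [set x | (rank d \o P) x == r]%SET = leaves d A.
    move=> AI <-; apply/setP => x; rewrite -(leaf_parentE dU X0 X1) // inE /=.
    by apply/eqP/eqP => [/(rank_inj dI (PI x) AI)|<-].
  have fibe B : B \in inners e -> rank e B = r ->
      [set y | (rank e \o Q) y == r]%SET = leaves e B.
    move=> BI <-; apply/setP => y; rewrite -(leaf_parentE eU Y0 Y1) // inE /=.
    by apply/eqP/eqP => [/(rank_inj eI (QI y) BI)|<-].
  have [rN|rN] := ltnP r #|inners d|.
    have [A AI rkA] := rank_surj dI rN; have [B BI rkB] := matched_exists AI.
    by rewrite (fibd A) // (fibe B) -?rkB //; exact: matched_leaves.
  transitivity 0%N; [|apply/esym]; apply/eqP; rewrite cards_eq0;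
    apply/eqP/setP => z; rewrite !inE /=; apply/negbTE; apply: contraTneq rN => <-;
    rewrite -ltnNge; first exact: rank_lt_card.
  by rewrite -(card_inners dU eU Fiso) rank_lt_card.
exists Phi => //.
(* Membership in an inner node is inclusion of the leaf parent, which [matched_subset] transfers. *)
have memPhi x A B : A \in inners d -> B \in inners e -> rank d A = rank e B ->
    (Phi x \in B) = (x \in A).
  move=> AI BI rkAB; rewrite (mem_leaf_parent dU X0 X1) // (mem_leaf_parent eU Y0 Y1) //.
  by apply/esym/matched_subset; rewrite ?PI ?QI //; exact: (esym (PhiE x)).
have rank_ball x y : x != y ->
    rank d (ball d x y) = rank e (ball e (Phi x) (Phi y)).
  move=> xy; have AI : ball d x y \in inners d by rewrite ball_inner.
  have BI : ball e (Phi x) (Phi y) \in inners e.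
    by rewrite ball_inner // (inj_eq (bij_inj Phi_bij)).
  have [B' B'I rkB'] := matched_exists AI.
  have [A' A'I rkA'] := matched_exists_inv BI.
  (* Both inclusions hold because a ball spanned by two points is the smallest ball containing them:
     through [A'] in [X], then through [B'] in [Y]. *)
  rewrite rkB'; congr (rank e _); apply/eqP; rewrite finset.eqEsubset; apply/andP; split.
    rewrite -(matched_subset AI A'I B'I BI rkB' rkA') ball_min ?(inner_ball dU A'I) //.
      by rewrite -(memPhi x _ _ A'I BI rkA') mem_balll.
    by rewrite -(memPhi y _ _ A'I BI rkA') mem_ballr.
  apply: ball_min; rewrite ?(inner_ball eU B'I) //.
    by rewrite (memPhi x _ _ AI B'I rkB') mem_balll.
  by rewrite (memPhi y _ _ AI B'I rkB') mem_ballr.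
move=> x y x' y'.
(* Distance 0 belongs to leaves, so it is settled before ranks are used. *)
have [<-|xy'] := eqVneq x' y'.
  by rewrite !dist_xx // !ltNge (ultra_ge0 dU) (ultra_ge0 eU).
have Phi_eq u v : (Phi u == Phi v) = (u == v) := inj_eq (bij_inj Phi_bij) u v.
have [<-|xy] := eqVneq x y.
  by rewrite !dist_xx // !dist_gt0 // Phi_eq.
(* Distances between distinct points are labels of inner nodes, and a larger label means a smaller
   rank. *)
rewrite -!(diam_ball dU) -!(diam_ball eU) -(rank_ltE dI) ?ball_inner //.
by rewrite -(rank_ltE eI) ?ball_inner ?Phi_eq // !rank_ball.
Qed.

End Sufficiency.

Theorem theorem2p7 (R : realType) (X : finType) (d : X -> X -> R)
    (X_nonempty : (0 < #|X|)%N) (d_ultra : is_ultrametric d)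
    (dD : class_D d) :
  (forall (Y : finType) (e : Y -> Y -> R),
     (0 < #|Y|)%N -> is_ultrametric e -> class_D e ->
     rooted_iso (repr_tree d) (repr_tree e) -> weakly_similar d e)
  <-> class_T d.
Proof.
have dI := (class_DP d_ultra X_nonempty).1 dD.
split=> [similar|/(class_TP d_ultra X_nonempty) dT Y e Y0 eU eD].
  by apply/(class_TP d_ultra X_nonempty)/homogeneous_of_similar.
case/(tree_iso_of_rooted_iso d_ultra eU X_nonempty Y0) => F Fiso.
have eI := (class_DP eU Y0).1 eD.
exact: weakly_similar_of_tree_iso Fiso dT.
Qed.
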